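(* For all indices $\mathbf k$ and $\mathbf l$, \[\zeta^{s,t,ш}_{\widehat{\mathcal S}}(\mathbf l\,ш_s\,\mathbf k)=(-1)^{\mathrm{wt}(\mathbf l)}\sum_{\mathbf n\in\mathbb Z_{\ge0}^{\mathrm{dep}(\mathbf l)}}b\binom{\mathbf l}{\mathbf n}\,\zeta^{s,t,ш}_{\widehat{\mathcal S}}\bigl(\mathbf k,\overleftarrow{\mathbf l\oplus\mathbf n}\bigr)\,t^{\mathrm{wt}(\mathbf n)},\] where $\zeta^{s,t,ш}_{\widehat{\mathcal S}}(\cdot)$ means $\zeta^{s,t,ш}_{\widehat{\mathcal S}}(\cdot;0,0)$ and $(\mathbf k,\overleftarrow{\mathbf l\oplus\mathbf n})$ is concatenation. In particular the same identity holds for $\zeta^{s,t}_{\widehat{\mathcal S}}$ in $(\mathcal Z/\zeta(2)\mathcal Z)[[s,t]]$.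
   Context: $s,t,T,T_1,T_2$ are commuting indeterminates. Index notation: an index is a finite tuple $\mathbf{k}=(k_1,\dots,k_r)$ of positive integers ($r\ge0$; the empty index is $\varnothing$), with depth $\mathrm{dep}(\mathbf{k})=r$ and weight $\mathrm{wt}(\mathbf{k})=k_1+\cdots+k_r$. For $0\le i\le r$, $\mathbf{k}_{[i]}=(k_1,\dots,k_i)$, $\mathbf{k}^{[i]}=(k_{i+1},\dots,k_r)$, $\overleftarrow{\mathbf{k}}=(k_r,\dots,k_1)$. For tuples of equal length, $\mathbf{k}\oplus\mathbf{l}=(k_1+l_1,\dots,k_r+l_r)$ and $b\binom{\mathbf{k}}{\mathbf{l}}=\prod_{i}\binom{k_i+l_i-1}{l_i}$. Admissible index: empty or $k_r\ge2$; $\zeta(\mathbf{k})=\sum_{0<n_1<\cdots<n_r}n_1^{-k_1}\cdots n_r^{-k_r}$, $\zeta(\varnothing)=1$; $\mathcal Z$ is the $\mathbb Q$-algebra generated by these values. Words: $\mathfrak H=\mathbb Q\langle e_0,e_1\rangle$, $\mathfrak H^1=\mathbb Q+e_1\mathfrak H$, $\mathfrak H^0=\mathbb Q+e_1\mathfrak He_0$, $e_{\mathbf{k}}=e_1e_0^{k_1-1}\cdots e_1e_0^{k_r-1}$ ($e_\varnothing=1$). The shuffle product $ш$ on $\mathfrak H$ is bilinear with $1ш w=wш1=w$, $we_iш w'e_j=(we_iш w')e_j+(wш w'e_j)e_i$; it is extended coefficientwise (bilinearly) to $\mathfrak H[[s]]$. The $s$-shifted shuffle product on $\mathfrak H[[s]]$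 is $w\,ш_s\,w'=(1-e_0s)\bigl(w\,ш\,(1-e_0s)^{-1}w'\bigr)$; it preserves $\mathfrak H^1[[s]]$. Products of (formal linear combinations of) indices are transported via the linear bijection $\mathbf k\mapsto(-1)^{\mathrm{dep}(\mathbf k)}e_{\mathbf k}$ between formal $\mathbb Q$-linear combinations of indices and $\mathfrak H^1$ (coefficientwise in $s$). Maps on indices are extended $\mathbb Q$-linearly and coefficientwise in $s$ (i.e. $\zeta(\sum_m c_ms^m):=\sum_m\zeta(c_m)s^m$). Regularized values: $Z:\mathfrak H^0\to\mathbb R$, $Z(e_{\mathbf k})=(-1)^{\mathrm{dep}(\mathbf k)}\zeta(\mathbf k)$; $Z^{ш}_T:\mathfrak H^1\to\mathbb R[T]$ is the unique $\mathbb Q$-algebra homomorphism for $ш$ extending $Z$ with $Z^{ш}_T(e_1)=-T$; $\zeta^{ш}(\mathbf k;T)=(-1)^{\mathrm{dep}(\mathbf k)}Z^{ш}_T(e_{\mathbf k})$; the same for the harmonic product gives $\zeta^{*}(\mathbf k;T)$. Shifted values: $\zeta^{t,\bullet}_{\mathrm{shift}}(\mathbf{k};T)=\sum_{\mathbf n\in\mathbb Z_{\ge0}^{\mathrm{dep}(\mathbf k)}}b\binom{\mathbf k}{\mathbf n}\zeta^{\bullet}(\mathbf k\oplus\mathbf n;T)(-t)^{\mathrm{wt}(\mathbf n)}$ (also with $t$ replaced by $s$ or $-t$). $(s,t)$-adic SMZVs: $\zeta^{s,t,\bullet}_{\widehat{\mathcal S}}(\mathbf k;T_1,T_2)=\sum_{i=0}^{r}(-1)^{\mathrm{wt}(\mathbf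 k^{[i]})}\zeta^{s,\bullet}_{\mathrm{shift}}(\mathbf k_{[i]};T_1)\zeta^{-t,\bullet}_{\mathrm{shift}}(\overleftarrow{\mathbf k^{[i]}};T_2)$, and $\zeta^{s,t}_{\widehat{\mathcal S}}(\mathbf k)$ is the image of $\zeta^{s,t,\bullet}_{\widehat{\mathcal S}}(\mathbf k;T,T)$ in $(\mathcal Z/\zeta(2)\mathcal Z)[[s,t]]$ (independent of $T,\bullet$). *)

(* Defs.v *)
From HB Require Import structures.
From mathcomp Require Import all_boot all_order all_algebra.
From mathcomp Require Import all_classical all_reals all_analysis.
Set Implicit Arguments. Unset Strict Implicit. Unset Printing Implicit Defensive.
Import Order.TTheory GRing.Theory Num.Theory numFieldNormedType.Exports.
Local Open Scope ring_scope.

(* An index is a seq nat (entries positive, imposed as hypotheses).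
   A word in H = Q<e0,e1> is a seq bool : true = e1, false = e0. *)
Definition word := seq bool.

Definition wordOf (k : seq nat) : word :=
  flatten [seq true :: nseq x.-1 false | x <- k].

(* candidate index decomposition of a word (only meaningful when the word is
   of the form e_k; validity is tested by [wordOf (idx w) == w]) *)
Definition idx (w : word) : seq nat :=
  rev (foldl (fun st (b : bool) => if b then 1%N :: st
               else match st with [::] => [::] | x :: st' => x.+1 :: st' end)
             [::] w).

(* formal Z-linear combinations of words (elements of H) *)
Definition lc := seq (int * word).

(* shuffle product of words, defined on reversed words following
   w e_i ш w' e_j = (w e_i ш w') e_j + (w ш w' e_j) e_i ;
   the result is the multiset of words (each with coefficient 1). *)
Fixpoint shrev (a b : word) {struct a} : seq word :=
  match a with
  | [::] => [:: b]
  | x :: a' =>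
      let fix aux (b : word) : seq word :=
        match b with
        | [::] => [:: a]
        | y :: b' => [seq y :: z | z <- aux b'] ++ [seq x :: z | z <- shrev a' b]
        end in aux b
  end.

Definition shuffle (w w' : word) : seq word :=
  [seq rev z | z <- shrev (rev w) (rev w')].

(* coefficient of s^m in  w ш_s w' = (1 - e0 s)(w ш (1 - e0 s)^{-1} w'),
   with (1 - e0 s)^{-1} = sum_j e0^j s^j *)
Definition shs_coef (w w' : word) (m : nat) : lc :=
  [seq (1%:Z, z) | z <- shuffle w (nseq m false ++ w')] ++
  (if m is m'.+1 then [seq (- 1%:Z, false :: z) | z <- shuffle w (nseq m' false ++ w')]
   else [::]).

Section Zeta.
Variable R : realType.

Fixpoint zt (k : seq nat) (a N : nat) : R :=
  match k with
  | [::] => 1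
  | x :: k' => \sum_(a.+1 <= n < N) ((n%:R) ^- x * zt k' n N)
  end.

Definition mzv (k : seq nat) : R := limn (fun N : nat => zt k 0 N).

Definition Zw (v : word) : R := (-1) ^+ size (idx v) * mzv (idx v).

(* zreg T m v = Z^ш_T (v e1^m), for v in H^0 (empty or starting with e1 and
   ending with e0).  It is the unique shuffle homomorphism extension, computed
   from  Z^ш_T(v e1^m) Z^ш_T(e1) = Z^ш_T(v e1^m ш e1)  with Z^ш_T(e1) = -T:
   (m+1) Z(v e1^{m+1}) = -T Z(v e1^m) - sum_{i<|v|} Z((e1 inserted at i in v) e1^m). *)
Fixpoint zreg (T : R) (m : nat) (v : word) : R :=
  match m with
  | 0 => Zw v
  | m'.+1 => (- T * zreg T m' v
              - \sum_(i < size v) zreg T m' (take i v ++ true :: drop i v))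
             / (m'.+1)%:R
  end.

Definition Zsh (T : R) (w : word) : R :=
  let m := find negb (rev w) in zreg T m (take (size w - m) w).

Definition zsh (T : R) (k : seq nat) : R := (-1) ^+ size k * Zsh T (wordOf k).

Fixpoint wcomps (r a : nat) : seq (seq nat) :=
  match r with
  | 0 => if a == 0%N then [:: [::]] else [::]
  | r'.+1 => flatten [seq [seq j :: c | c <- wcomps r' (a - j)] | j <- iota 0 a.+1]
  end.

Definition oplus (k n : seq nat) : seq nat := [seq p.1 + p.2 | p <- zip k n]%N.
Definition bcoef (k n : seq nat) : nat :=
  \prod_(p <- zip k n) 'C(p.1 + p.2 - 1, p.2).

(* coefficient of x^a in zeta^{c x, ш}_shift(k; T)
   = sum_n b(k;n) zeta^ш(k (+) n; T) (-c x)^{wt n};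
   c = 1 gives zeta^{s}_shift, c = -1 gives zeta^{-t}_shift *)
Definition shiftc (c T : R) (k : seq nat) (a : nat) : R :=
  \sum_(n <- wcomps (size k) a) (bcoef k n)%:R * zsh T (oplus k n) * (- c) ^+ a.

(* coefficient of s^a t^b in zeta^{s,t,ш}_S^(k; T1, T2) *)
Definition zhatc (T1 T2 : R) (k : seq nat) (a b : nat) : R :=
  \sum_(i < (size k).+1)
    (-1) ^+ sumn (drop i k) * shiftc 1 T1 (take i k) a
                            * shiftc (-1) T2 (rev (drop i k)) b.

(* the same, applied to a word via the bijection k |-> (-1)^dep(k) e_k
   (words not of the form e_k get 0; they cancel in elements of H^1) *)
Definition zhatw (T1 T2 : R) (w : word) (a b : nat) : R :=
  if wordOf (idx w) == w then (-1) ^+ size (idx w) * zhatc T1 T2 (idx w) a b else 0.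

Definition lhs_coef (l k : seq nat) (a b : nat) : R :=
  (-1) ^+ (size l + size k) *
  \sum_(m < a.+1) \sum_(p <- shs_coef (wordOf l) (wordOf k) m)
      (p.1)%:~R * zhatw 0 0 p.2 (a - m) b.

Definition rhs_coef (l k : seq nat) (a b : nat) : R :=
  (-1) ^+ sumn l *
  \sum_(c < b.+1) \sum_(n <- wcomps (size l) c)
      (bcoef l n)%:R * zhatc 0 0 (k ++ rev (oplus l n)) a (b - c).

End Zeta.

(* Main.v *)
Require Import Defs.
From mathcomp Require Import all_boot all_order all_algebra.
From mathcomp Require Import all_classical all_reals all_analysis.
From mathcomp Require Import zify ring lra.

(** The shuffle-regularized zeta values extend to a character Z of the shuffle
    algebra on all words with Z(e0) = Z(e1) = 0, and sum_n b(k;n) zeta(k + n) (-s)^n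
    becomes Z((1 - e0 s)^-1 e_k) up to sign. Hence the (s,t)-adic symmetric value
    of k is, up to sign, F((1 - e0 s)^-1 e_k e1 (1 - e0 t)^-1), where F is the
    convolution of Z, the indicator of the letter e1, and Z composed with the
    antipode S. F is the coefficient functional of the Lie series Phi e1 Phi^-1, so
    it kills all shuffle products of nonempty words, whence
    F((u sh w) e1 v) = F(w e1 (S(u) sh v)). With u = e_l,
    w = (1 - e0 s)^-1 e_k, v = (1 - e0 t)^-1 this is the theorem. *)

Set Implicit Arguments. Unset Strict Implicit. Unset Printing Implicit Defensive.
Import Order.TTheory GRing.Theory Num.Theory numFieldNormedType.Exports.
Local Open Scope ring_scope.

(** * Sums over shuffles and deconcatenations *)

Section ShuffleSum.
Variable V : nmodType.
Implicit Types (f : word -> V) (u v w : word) (c : bool).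

(** A linear functional evaluated on a shuffle product. [shrev] recurses on first letters;
    [shsum_rev] shows that recursion on last letters gives the same sum. *)
Definition shsum f u v : V := \sum_(z <- shrev u v) f z.

Lemma shsum0l f v : shsum f [::] v = f v.
Proof. by rewrite /shsum /= big_seq1. Qed.

Lemma shsum0r f u : shsum f u [::] = f u.
Proof. by case: u => [|x u]; rewrite /shsum /= big_seq1. Qed.

Lemma shsum_cons f x y u v :
  shsum f (x :: u) (y :: v) =
  shsum (fun z => f (x :: z)) u (y :: v) + shsum (fun z => f (y :: z)) (x :: u) v.
Proof. by rewrite /shsum /= big_cat /= !big_map addrC. Qed.

Lemma eq_shsum f g u v : f =1 g -> shsum f u v = shsum g u v.
Proof. by move=> fg; apply: eq_bigr. Qed.

Lemma shsum_add f g u v : shsum (fun z => f z + g z) u v = shsum f u v + shsum g u v.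
Proof. by rewrite /shsum big_split. Qed.

Lemma shsumC f u v : shsum f u v = shsum f v u.
Proof.
elim: u v f => [|x u IHu] v f; first by rewrite shsum0l shsum0r.
elim: v f => [|y v IHv] f; first by rewrite shsum0l shsum0r.
by rewrite !shsum_cons IHu IHv addrC.
Qed.

Lemma shsumA f u v w :
  shsum (fun z => shsum f z w) u v = shsum (fun z => shsum f u z) v w.
Proof.
elim: u v w f => [|x u IHu] v w f.
  by rewrite shsum0l; apply: eq_shsum => z; rewrite shsum0l.
elim: v w f => [|y v IHv] w f; first by rewrite shsum0l shsum0r.
elim: w f => [|a w IHw] f.
  by rewrite shsum0r; apply: eq_shsum => z; rewrite shsum0r.
have E c : (fun z => shsum f (c :: z) (a :: w)) =1
    (fun z => shsum (fun t => f (c :: t)) z (a :: w) +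
              shsum (fun t => f (a :: t)) (c :: z) w).
  by move=> z; rewrite shsum_cons.
have E' c : (fun z => shsum f (x :: u) (c :: z)) =1
    (fun z => shsum (fun t => f (x :: t)) u (c :: z) +
              shsum (fun t => f (c :: t)) (x :: u) z).
  by move=> z; rewrite shsum_cons.
rewrite !shsum_cons (eq_shsum _ _ (E x)) (eq_shsum _ _ (E y)).
rewrite (eq_shsum _ _ (E' y)) (eq_shsum _ _ (E' a)) !shsum_add IHu IHv.
(* The two groups of words starting with [a] recombine into one double sum, to which [IHw]
   applies. *)
have IH := IHw (fun t => f (a :: t)); rewrite shsum_cons in IH.
by rewrite -IH addrACA shsum_cons [RHS]addrA; congr (_ + _); rewrite addrAC.
Qed.

Lemma shsum_rcons f x y u v :
  shsum f (rcons u x) (rcons v y) =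
  shsum (fun z => f (rcons z x)) u (rcons v y) +
  shsum (fun z => f (rcons z y)) (rcons u x) v.
Proof.
elim: u v f => [|a u IHu] v f.
  rewrite shsum0l; elim: v f => [|b v IHv] f.
    by rewrite !shsum_cons !shsum0r !shsum0l addrC.
  rewrite /= !shsum_cons IHv !shsum0l !addrA.
  by congr (_ + _); rewrite addrC.
elim: v f => [|b v IHv] f.
  rewrite shsum0r /= !shsum_cons (IHu [::]) !shsum0r /= addrAC -addrA.
  by congr (_ + _); rewrite addrC.
by rewrite /= !shsum_cons -!rcons_cons IHv !rcons_cons -rcons_cons IHu addrACA.
Qed.

Lemma shsum_rev f u v : shsum f (rev u) (rev v) = shsum (fun z => f (rev z)) u v.
Proof.
elim: u v f => [|x u IHu] v f; first by rewrite !shsum0l.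
elim: v f => [|y v IHv] f; first by rewrite !shsum0r.
rewrite !rev_cons shsum_rcons -!rev_cons IHu IHv shsum_cons.
by congr (_ + _); apply: eq_shsum => z; rewrite rev_cons.
Qed.

Lemma sum_shuffle f u v : \sum_(z <- shuffle u v) f z = shsum f u v.
Proof.
rewrite /shuffle big_map -/(shsum (fun z => f (rev z)) (rev u) (rev v)) shsum_rev.
by apply: eq_shsum => z; rewrite revK.
Qed.

(** [phi] applied to the deconcatenation coproduct of [w]. *)
Fixpoint cosum (phi : word -> word -> V) w : V :=
  if w is x :: w' then phi [::] w + cosum (fun p => phi (x :: p)) w'
  else phi [::] [::].

Lemma eq_cosum phi psi w : phi =2 psi -> cosum phi w = cosum psi w.
Proof. by elim: w phi psi => [|x w IH] phi psi E /=; rewrite ?E // (IH _ _ (fun p => E _)). Qed.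

Lemma cosum_add phi psi w :
  cosum (fun p q => phi p q + psi p q) w = cosum phi w + cosum psi w.
Proof.
elim: w phi psi => //= x w IH phi psi.
by rewrite (IH (fun p => phi (x :: p)) (fun p => psi (x :: p))) addrACA.
Qed.

(** The marked letter [a] cuts every shuffle in two: a prefix [p] of [u] is shuffled into [w], the
    rest [q] into [v]. *)
Lemma shsum_deconc f u w a v :
  shsum f u (w ++ a :: v) =
  cosum (fun p q => shsum (fun z1 => shsum (fun z2 => f (z1 ++ a :: z2)) q v) p w) u.
Proof.
elim: u w f => [|x u IHu] w f; first by rewrite /= !shsum0l.
elim: w f => [|b w IHw] f.
  rewrite shsum_cons -[a :: v]cat0s IHu /= shsum0l addrC.
  by congr (_ + _); apply: eq_cosum => p q; rewrite !shsum0r.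
rewrite cat_cons shsum_cons -cat_cons IHu IHw /= !shsum0l addrCA -cosum_add.
by congr (_ + _); apply: eq_cosum => p q; rewrite shsum_cons.
Qed.

(** The bialgebra axiom: deconcatenation is a morphism for the shuffle product. *)
Lemma shsum_cosum (phi : word -> word -> V) u v :
  shsum (cosum phi) u v =
  cosum (fun u1 u2 => cosum (fun v1 v2 =>
     shsum (fun x => shsum (phi x) u2 v2) u1 v1) v) u.
Proof.
elim: u v phi => [|a u IHu] v phi.
  by rewrite shsum0l; apply: eq_cosum => p q; rewrite !shsum0l.
elim: v phi => [|b v IHv] phi.
  by rewrite shsum0r; apply: eq_cosum => p q; rewrite /= !shsum0r.
rewrite shsum_cons [in LHS]/= !shsum_add IHu IHv addrACA -shsum_cons /=.
rewrite !shsum0l -!addrA; congr (_ + _).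
rewrite addrCA -cosum_add; congr (_ + _).
  by apply: eq_cosum => p q; rewrite !shsum0l.
apply: eq_cosum => p q; rewrite /= !shsum0r -addrA -cosum_add; congr (_ + _).
by apply: eq_cosum => p' q'; rewrite shsum_cons.
Qed.

End ShuffleSum.

Section Antipode.
Variable R : pzRingType.
Implicit Types (f : word -> R) (u v w : word).

Lemma shsumZ c f u v : shsum (fun z => c * f z) u v = c * shsum f u v.
Proof. by rewrite /shsum big_distrr. Qed.

Lemma cosumZ c (phi : word -> word -> R) w :
  cosum (fun p q => c * phi p q) w = c * cosum phi w.
Proof. by elim: w phi => //= x w IH phi; rewrite IH mulrDr. Qed.

Lemma cosumZr c (phi : word -> word -> R) w :
  cosum (fun p q => phi p q * c) w = cosum phi w * c.
Proof. by elim: w phi => //= x w IH phi; rewrite IH mulrDl. Qed.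

Lemma shuffle_antipode f x w :
  cosum (fun p q => (-1) ^+ size p * shsum f (rev p) q) (x :: w) = 0.
Proof.
(* telescoping, with the reversed prefix y :: p accumulated on the left *)
have G : forall w (y : bool) (p : word) (g : word -> R), cosum (fun p' q => (-1) ^+ size p' *
    shsum g (catrev p' (y :: p)) q) w = shsum (fun z => g (y :: z)) p w.
  clear; elim=> [|a w IH] y p g; first by rewrite /= mul1r !shsum0r.
  rewrite /= mul1r shsum_cons.
  rewrite -addrA -[RHS]addr0; congr (_ + _).
  under [X in _ + X]eq_cosum => p' q do rewrite exprS -mulrA.
  by rewrite cosumZ IH mulN1r subrr.
rewrite /= mul1r shsum0l.
under [X in _ + X]eq_cosum => p q do rewrite exprS -mulrA /rev /=.
by rewrite cosumZ G shsum0l mulN1r subrr.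
Qed.

End Antipode.

(** * Characters of the shuffle algebra *)

Lemma perm_shrev u v z : z \in shrev u v -> perm_eq z (u ++ v).
Proof.
elim: u v z => [|x u IHu] v z; first by rewrite inE => /eqP->.
elim: v z => [|y v IHv] z; first by rewrite inE cats0 => /eqP->.
rewrite /= mem_cat => /orP[] /mapP[t tin ->].
  by rewrite -cat_cons perm_sym perm_catC /= perm_cons perm_catC perm_sym IHv.
by rewrite perm_cons IHu.
Qed.

Lemma size_shrev u v z : z \in shrev u v -> size z = (size u + size v)%N.
Proof. by move=> /perm_shrev/perm_size ->; rewrite size_cat. Qed.

Lemma eq_in_shsum (V : nmodType) (f g : word -> V) u v :
  {in shrev u v, f =1 g} -> shsum f u v = shsum g u v.
Proof. by move=> fg; apply: eq_big_seq. Qed.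

Lemma eq_in_cosum (V : nmodType) (phi psi : word -> word -> V) w :
  (forall p q, p ++ q = w -> phi p q = psi p q) -> cosum phi w = cosum psi w.
Proof.
elim: w phi psi => [|x w IH] phi psi E /=; first exact: E.
by rewrite E //; congr (_ + _); apply: IH => p q pq; apply: E; rewrite -pq.
Qed.

Lemma cosum_last (V : nmodType) (phi : word -> word -> V) w :
  (forall p q, p ++ q = w -> q != [::] -> phi p q = 0) -> cosum phi w = phi w [::].
Proof.
elim: w phi => [|x w IH] phi E //=.
by rewrite E // add0r; apply: IH => p q pq; apply: E; rewrite -pq.
Qed.

Section Characters.
Variable R : comNzRingType.
Implicit Types (f F : word -> R) (u v w : word).

Definition shuffle_hom f := f [::] = 1 /\ forall u v, shsum f u v = f u * f v.

Lemma shuffle_hom_rev f : shuffle_hom f -> shuffle_hom (fun w => f (rev w)).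
Proof. by move=> [f1 fM]; split => // u v; rewrite -shsum_rev fM. Qed.

Definition antipode f w := (-1) ^+ size w * f (rev w).

Lemma shuffle_hom_antipode f : shuffle_hom f -> shuffle_hom (antipode f).
Proof.
move=> homf; split=> [|u v]; first by rewrite /antipode mul1r homf.1.
rewrite (eq_in_shsum (g := fun z => (-1) ^+ (size u + size v) * f (rev z))); last first.
  by move=> z /size_shrev <-.
by rewrite shsumZ (shuffle_hom_rev homf).2 /antipode exprD mulrACA.
Qed.

(** Composing a character with S gives its convolution inverse: multiplicativity reduces this to
    [shuffle_antipode] for the character f o rev. *)
Lemma shuffle_hom_inv f w : shuffle_hom f ->
  cosum (fun p q => f p * antipode f q) w = (w == [::])%:R.
Proof.
move=> homf; case: w => [|x w]; first by rewrite /= /antipode !homf.1 !mulr1.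
have [_ fM] := shuffle_hom_rev homf.
rewrite (eq_in_cosum (psi := fun p q => (-1) ^+ size (x :: w) *
    ((-1) ^+ size p * shsum (fun z => f (rev z)) (rev p) q))).
  by rewrite cosumZ shuffle_antipode mulr0.
move=> p q <-; rewrite fM revK /antipode mulrCA !mulrA -exprD size_cat.
by rewrite addnAC addnn exprD -mul2n exprM sqrrN !expr1n mul1r mulrAC.
Qed.

(* coefficient of w in Phi e1 Phi^-1, where Phi is the generating series of f *)
Definition conj_coef f w : R :=
  cosum (fun p q => f p * (if q is true :: q' then antipode f q' else 0)) w.

(** On a shuffle of [u] and [v] the two characters multiply and the indicator of e1 acts as a
    derivation. Each of the two resulting terms contains the convolution of f and f o S at [u] or at
    [v], which vanishes on nonempty words. *)
Lemma conj_coef_shuffle f u v : shuffle_hom f -> u != [::] -> v != [::] ->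
  shsum (conj_coef f) u v = 0.
Proof.
move=> homf u0 v0; have [S1 SM] := shuffle_hom_antipode homf.
pose psi (q : word) := if q is true :: q' then antipode f q' else 0.
change (shsum (cosum (fun p q => f p * psi q)) u v = 0).
(* A shuffle starts with the first letter of [u2] or of [v2], and [psi] removes that letter if it is
   e1. *)
have psiM u2 v2 : shsum psi u2 v2 = psi u2 * antipode f v2 + antipode f u2 * psi v2.
  case: u2 => [|a u2]; first by rewrite shsum0l S1 mul0r mul1r add0r.
  case: v2 => [|b v2]; first by rewrite shsum0r S1 mulr0 mulr1 addr0.
  rewrite shsum_cons; congr (_ + _).
    case: a; first by rewrite -SM.
    by rewrite mul0r /shsum big1.
  case: b; first by rewrite -SM.
  by rewrite mulr0 /shsum big1.
rewrite shsum_cosum.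
under eq_cosum => u1 u2.
  under eq_cosum => v1 v2.
    rewrite (eq_shsum (g := fun x => shsum psi u2 v2 * f x)); last first.
      by move=> x; rewrite shsumZ mulrC.
    rewrite shsumZ homf.2 psiM.
    have -> : (psi u2 * antipode f v2 + antipode f u2 * psi v2) * (f u1 * f v1) =
      (f u1 * psi u2) * (f v1 * antipode f v2) + (f u1 * antipode f u2) * (f v1 * psi v2).
      by rewrite mulrC mulrDr mulrACA [in X in _ + X]mulrACA.
    over.
  rewrite cosum_add !cosumZ shuffle_hom_inv // (negbTE v0) mulr0 add0r.
  over.
by rewrite cosumZr shuffle_hom_inv // (negbTE u0) mul0r.
Qed.

(* In the shuffle algebra, (u sh w) a v is the sum over u = p q r of
   p sh (w a (S(q) sh v)); a functional killing the terms with p nonempty sees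
   only w a (S(u) sh v). *)
Lemma shsum_cat_antipode F u w a v :
  (forall p y, prefix p u -> p != [::] -> y != [::] -> shsum F p y = 0) ->
  shsum (fun z => F (z ++ a :: v)) u w =
  (-1) ^+ size u * shsum (fun z => F (w ++ a :: z)) (rev u) v.
Proof.
have [n] := ubnP (size u); elim: n u v => // n IH u v lt_un F0.
have [->|u0] := eqVneq u [::]; first by rewrite !shsum0l mul1r.
set g := fun z => F (w ++ a :: z).
pose A p q := (-1) ^+ size p * shsum (fun z => shsum g z v) (rev p) q.
pose B p q := shsum (fun z1 => shsum (fun z2 => F (z1 ++ a :: z2)) q v) p w.
have A0 : cosum A u = 0 by case: (u) u0 => // x u' _; rewrite shuffle_antipode.
have B0 : cosum B u = 0.
  by rewrite -shsum_deconc F0 ?prefix_refl //; case: (w).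
(* Induction on the prefix [p], shorter than [u] because [q] is nonempty. The two vanishing sums can
   then differ only in the term p = u. *)
have AB p q : p ++ q = u -> q != [::] -> B p q = A p q.
  move=> pq q0; rewrite /B /A shsumA /shsum exchange_big big_distrr /=.
  apply: eq_bigr => v' _; apply: IH.
    by move: lt_un; rewrite -pq size_cat; case: (q) q0 => //= b q' _; lia.
  by move=> p' y pp'; apply: F0; apply: prefix_trans pp' _; rewrite -pq prefix_prefix.
have : cosum (fun p q => B p q + (-1) * A p q) u = 0.
  by rewrite cosum_add cosumZ A0 B0 mulr0 addr0.
rewrite cosum_last => [|p q pq q0]; last by rewrite AB // mulN1r subrr.
rewrite mulN1r => /subr0_eq; rewrite /A /B shsum0r => <-.
by apply: eq_shsum => z; rewrite shsum0l.
Qed.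

End Characters.

(** * Extending a shuffle character by a letter of value zero *)

Section Regularization.
Variables (R : numFieldType) (c : bool).
Implicit Types (f h : word -> R) (u v w : word).

Definition nonlead w := if w is x :: _ then x != c else true.

Lemma split_lead w : exists m v, nonlead v /\ w = nseq m c ++ v.
Proof.
elim: w => [|x w [m [v [nv ->]]]]; first by exists 0%N, [::].
have [->|xc] := eqVneq x c; first by exists m.+1, v.
by exists 0%N, (x :: nseq m c ++ v).
Qed.

(* value on c^m v of the extension of f on which c has value 0 *)
Fixpoint reg f (m : nat) v : R :=
  if m is m'.+1 then
    - (if v is y :: v' then shsum (fun z => reg f m' (y :: z)) [:: c] v' else 0) / m%:R
  else f v.

(** Two uses: c = e1 on reversed words recovers [Zsh 0]; c = e0 extends it from H^1 to all words. *)
Definition ext f w := let m := find (fun x => x != c) w in reg f m (drop m w).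

Lemma ext_nseq f m v : nonlead v -> ext f (nseq m c ++ v) = reg f m v.
Proof.
move=> nv; rewrite /ext; suff -> : find (fun x => x != c) (nseq m c ++ v) = m.
  by rewrite drop_size_cat // size_nseq.
elim: m => [|m IH] /=; last by rewrite eqxx IH.
by case: v nv => //= x v ->.
Qed.

(** The m + 1 positions in and around the leading run c^m give the same word; the other insertions
    fall behind the first letter of [v]. *)
Lemma shsum_lead h m v : shsum h [:: c] (nseq m c ++ v) =
  h (nseq m.+1 c ++ v) *+ m.+1 +
  (if v is y :: v' then shsum (fun z => h (nseq m c ++ y :: z)) [:: c] v' else 0).
Proof.
elim: m h => [|m IH] h.
  by case: v => [|y v]; rewrite ?shsum0r ?addr0 //= shsum_cons shsum0l.
by rewrite shsum_cons shsum0l (IH (fun z => h (c :: z))) [in RHS]mulrS -addrA.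
Qed.

Lemma ext_shsum f w : shsum (ext f) [:: c] w = 0.
Proof.
have [m [v [nv ->]]] := split_lead w; rewrite shsum_lead ext_nseq //=.
case: v nv => [|y v] nv; first by rewrite oppr0 mul0r mul0rn add0r.
rewrite -[X in X + _]mulr_natr divfK ?pnatr_eq0 // addrC.
by apply/eqP; rewrite subr_eq0; apply/eqP; apply: eq_shsum => z; rewrite ext_nseq.
Qed.

(** [Q] marks the words spanning a shuffle subalgebra that contains c: later, the words that are
    empty or end in e1, or all words. *)
Variable Q : pred word.
Hypothesis Qshuffle : forall u v z, Q u -> Q v -> z \in shrev u v -> Q z.
Hypothesis Q0 : Q [::].
Hypothesis Qc : forall u, Q (c :: u) = Q u.
Variable h : word -> R.
Hypothesis hc : forall w, Q w -> shsum h [:: c] w = 0.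

Let Qnseq m u : Q (nseq m c ++ u) = Q u.
Proof. by elim: m => //= m IH; rewrite Qc. Qed.

Let lead_step v : Q v ->
  (forall u, nonlead u -> Q u -> shsum h u v = h u * h v) ->
  forall u, Q u -> shsum h u v = h u * h v.
Proof.
move=> Qv H u; have [m [{}u [nu ->]]] := split_lead u.
elim: m u nu => [|m IH] u nu; first exact: H.
rewrite Qnseq => Qu; have Qmu : Q (nseq m c ++ u) by rewrite Qnseq.
(* Both [h] and shuffling with [v] followed by [h] kill the shuffle of c with c^m u. By
   [shsum_lead], m + 1 times their value at c^(m+1) u is thus given by words with leading run
   c^m. *)
apply: (@pmulrnI _ m.+1) => //.
pose g z := shsum h z v.
have g0 : shsum g [:: c] (nseq m c ++ u) = 0.
  rewrite shsumA /shsum big1_seq // => z /andP[_ zin].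
  exact/hc/(Qshuffle Qmu Qv).
have h0 := hc Qmu.
move: g0 h0; rewrite !shsum_lead => /eqP; rewrite addr_eq0 => /eqP-> /eqP.
rewrite addr_eq0 -mulrnAl => /eqP->; rewrite mulNr; congr (- _).
case: u nu Qu {Qmu} => [|y u] nu Qu; first by rewrite mul0r.
rewrite mulrC -shsumZ; apply: eq_in_shsum => z zin.
rewrite /g (IH (y :: z)) ?Qnseq //; first by rewrite mulrC.
apply: Qshuffle (_ : y :: z \in shrev [:: c] (y :: u)) => //.
  by rewrite Qc.
by rewrite mem_cat map_f.
Qed.

Lemma shuffle_hom_lead :
  (forall u v, nonlead u -> nonlead v -> Q u -> Q v -> shsum h u v = h u * h v) ->
  forall u v, Q u -> Q v -> shsum h u v = h u * h v.
Proof.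
move=> H u v Qu Qv; apply: lead_step Qu => // {}u nu Qu.
rewrite shsumC mulrC; apply: lead_step Qv => // {}v nv Qv.
by rewrite shsumC mulrC; apply: H.
Qed.

End Regularization.

(** * Shuffle product of multiple zeta values *)

Lemma wordOf_rcons k x : wordOf (rcons k x) = wordOf k ++ true :: nseq x.-1 false.
Proof. by rewrite /wordOf map_rcons flatten_rcons. Qed.

Lemma idx_wordOf k : all (fun x => 0 < x)%N k -> idx (wordOf k) = k.
Proof.
set step := fun (st : seq nat) (b : bool) => if b then 1%N :: st
   else match st with [::] => [::] | x :: st' => x.+1 :: st' end.
have F n x st : foldl step (x :: st) (nseq n false) = (x + n)%N :: st.
  by elim: n x => [|n IH] x /=; rewrite ?addn0 // IH addnS.
suff H st : all (fun x => 0 < x)%N k -> foldl step st (wordOf k) = rev k ++ st.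
  by move=> k0; rewrite /idx H // cats0 revK.
elim: k st => [|[|x] k IH] st //= k0; rewrite /wordOf /= foldl_cat F IH //.
by rewrite rev_cons -cats1 -catA.
Qed.

(** The default [true] admits the empty word, so [head true w] says that [w] lies in H^1. *)
Lemma wordOfP w : head true w ->
  exists k, all (fun x => 0 < x)%N k /\ w = wordOf k.
Proof.
elim/last_ind: w => [|w b IH] hw; first by exists [::].
have /IH[k [k0 wk]] : head true w by case: w hw {IH}.
case: b hw => hw.
  by exists (rcons k 1); rewrite all_rcons k0 wordOf_rcons cats1 wk.
elim/last_ind: k k0 wk => [|k x _] k0 wk; first by rewrite wk in hw.
move: k0; rewrite all_rcons => /andP[x0 k0].
exists (rcons k x.+1); split; first by rewrite all_rcons k0.
rewrite wk !wordOf_rcons /= -[in RHS](prednK x0) -(addn1 x.-1) nseqD /=.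
by rewrite rcons_cat rcons_cons -cats1.
Qed.

Lemma count_idx w : head true w -> size (idx w) = count id w.
Proof.
move=> /wordOfP[k [k0 ->]]; rewrite idx_wordOf //.
elim: k k0 => //= x k IH /andP[_ /IH->].
by rewrite /wordOf /= count_cat count_nseq mul0n.
Qed.

Section NestedSums.
Variable R : realFieldType.
Implicit Types (a b : nat -> R) (u v : word) (n N : nat).

(* coefficient of X^n in the multiple polylogarithm of rev u: a leading letter
   of u is removed by X d/dX (e0) or by (1 - X) d/dX (e1) *)
Fixpoint pcoef u n : R :=
  match u with
  | [::] => (n == 0%N)%:R
  | x :: u' => (if x then \sum_(m < n) pcoef u' m else pcoef u' n) / n%:R
  end.

Lemma pcoef_ge0 u n : 0 <= pcoef u n.
Proof.
elim: u n => [|x u IH] n /=; first exact: ler0n.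
by case: x; rewrite divr_ge0 ?sumr_ge0.
Qed.

(** The convention 0^-1 = 0 encodes a zero constant of integration. *)
Lemma pcoef_cons0 x u : pcoef (x :: u) 0 = 0.
Proof. by rewrite /= invr0 mulr0. Qed.

Lemma pcoef_nseq j u n : pcoef (nseq j false ++ u) n = pcoef u n / n%:R ^+ j.
Proof.
elim: j => [|j IH]; first by rewrite expr0 divr1.
by rewrite /= IH exprS invfM mulrA -mulrA mulrAC mulrA.
Qed.

Definition cauchy_prod a b n := \sum_(i < n.+1) a i * b (n - i)%N.

Lemma cauchy_prodC a b n : cauchy_prod a b n = cauchy_prod b a n.
Proof.
rewrite /cauchy_prod (reindex_inj rev_ord_inj) /=; apply: eq_bigr => i _.
by rewrite mulrC subSS subKn // -ltnS.
Qed.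

Lemma sum_cauchy_prod a b N :
  \sum_(n < N) cauchy_prod a b n = \sum_(i < N) a i * \sum_(j < N - i) b j.
Proof.
elim: N => [|N IH]; first by rewrite !big_ord0.
rewrite big_ord_recr [RHS]big_ord_recr /= IH subSnn big_ord1 /cauchy_prod big_ord_recr /=.
rewrite addrA -big_split subnn; congr (_ + _); apply: eq_bigr => i _ /=.
by rewrite subSn ?big_ord_recr ?mulrDr // ltnW.
Qed.

(** Multiplication of the generating series by X/(1 - X) for e1 and by 1 for e0, hence compatible
    with Cauchy products. *)
Let L (x : bool) a n := if x then \sum_(m < n) a m else a n.

Let cauchy_prodL x a b n : cauchy_prod (L x a) b n = L x (cauchy_prod a b) n.
Proof.
case: x => //=; rewrite cauchy_prodC /cauchy_prod big_ord_recr /= subnn big_ord0 mulr0 addr0.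
by rewrite -sum_cauchy_prod; apply: eq_bigr => i _; rewrite cauchy_prodC.
Qed.

(** The Leibniz rule for X d/dX on a product of two polylogarithms is the shuffle recursion on first
    letters. *)
Lemma pcoefM u v n : last true u -> last true v ->
  cauchy_prod (pcoef u) (pcoef v) n = shsum (fun z => pcoef z n) u v.
Proof.
have one a m : cauchy_prod (pcoef [::]) a m = a m.
  rewrite /cauchy_prod big_ord_recl /= mul1r subn0 big1 ?addr0 // => i _.
  by rewrite mul0r.
elim: u v n => [|x u IHu] v n Qu Qv; first by rewrite shsum0l one.
elim: v n Qv => [|y v IHv] n Qv; first by rewrite shsum0r cauchy_prodC one.
have Lsum c s t : shsum (fun z => pcoef (c :: z) n) s t =
    L c (fun m => shsum (fun z => pcoef z m) s t) n / n%:R.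
  rewrite /L /= /shsum; case: c; rewrite -mulr_suml //.
  by rewrite exchange_big.
(* At m = 0 the right side vanishes because the last letter is e1, so [c :: s] is not the lone
   letter e0. *)
have theta c s m : last true (c :: s) -> pcoef (c :: s) m * m%:R = L c (pcoef s) m.
  case: m => [|m] Qs; last by rewrite /= divfK // pnatr_eq0.
  rewrite mulr0; case: c Qs => /=; first by rewrite big_ord0.
  by case: s => // c s _; rewrite pcoef_cons0.
rewrite shsum_cons !Lsum //.
have Lext c f g : f =1 g -> L c f n = L c g n.
  by move=> fg; rewrite /L; case: c => //; apply: eq_bigr.
have Qu' : last true u by case: (u) Qu; case: (x).
have Qv' : last true v by case: (v) Qv; case: (y).
rewrite -(Lext _ _ _ (fun m => IHu _ m Qu' Qv)) -(Lext _ _ _ (fun m => IHv m Qv')).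
have [->|n0] := eqVneq n 0%N.
  by rewrite invr0 !mulr0 addr0 /cauchy_prod big_ord1 pcoef_cons0 mul0r.
rewrite -cauchy_prodL (Lext _ _ _ (fun m => cauchy_prodC _ _ m)) -cauchy_prodL -mulrDl.
apply: (canRL (mulfK _)); first by rewrite pnatr_eq0.
rewrite [in X in _ = _ + X]cauchy_prodC /cauchy_prod -big_split mulr_suml; apply: eq_bigr => i _.
have nE : n%:R = i%:R + (n - i)%:R :> R by rewrite -natrD subnKC // -ltnS.
by rewrite -(theta x) // -(theta y) // nE mulrDr mulrAC mulrA.
Qed.

(** Summed over n first, a_m gets as weight the tail of 1/n^2 over n > m, at most 1/m for m > 0 and
    at most 2 for m = 0. *)
Lemma sum_pcoef_prefix a N : (forall n, 0 <= a n) ->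
  \sum_(n < N) (\sum_(m < n) a m) / n%:R / n%:R <=
  2 * a 0%N + \sum_(m < N) a m / m%:R.
Proof.
move=> a0; have a00 := a0 0%N.
case: N => [|[|M]]; first by rewrite !big_ord0; lra.
  by rewrite !big_ord1 big_ord0 !mul0r invr0 mulr0; lra.
(* the extra term is the tail of the series, from 1/n^2 <= 1/(n-1) - 1/n *)
suff : \sum_(n < M.+2) (\sum_(m < n) a m) / n%:R / n%:R +
       (\sum_(m < M.+2) a m) / M.+1%:R <=
  2 * a 0%N + \sum_(m < M.+2) a m / m%:R.
  apply: le_trans; rewrite lerDl divr_ge0 ?sumr_ge0 //.
elim: M => [|M IH].
  rewrite !big_ord_recr !big_ord0 /= invr0 divr1 !mulr0 !add0r !divr1; lra.
rewrite (big_ord_recr M.+2) (big_ord_recr M.+2) [in leRHS](big_ord_recr M.+2) /=.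
set A := \sum_(m < M.+2) a m in IH *.
set S := \sum_(n < M.+2) _ in IH *.
set T := \sum_(m < M.+2) a m / _ in IH *.
have A0 : 0 <= A by apply: sumr_ge0.
have x0 : (0 : R) < M.+1%:R by rewrite ltr0Sn.
have y0 : (0 : R) < M.+2%:R by rewrite ltr0Sn.
have key : M.+2%:R^-1 / M.+2%:R + M.+2%:R^-1 <= M.+1%:R^-1 :> R.
  rewrite -(ler_pM2r x0) -(ler_pM2r y0) -(ler_pM2r y0) mulVf ?gt_eqF // mul1r.
  rewrite -[M.+2%:R]natr1 in y0 *; set x := M.+1%:R in x0 y0 *.
  have -> : ((x + 1)^-1 / (x + 1) + (x + 1)^-1) * x * (x + 1) * (x + 1) =
      x * (x + 2) by field; rewrite gt_eqF.
  by nra.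
have := ler_wpM2l A0 key; rewrite mulrDl mulrDr mulrA => Akey.
move: Akey IH.
set p := A / _ / _; set q := A / M.+2%:R; set r := A / _; set t := a _ / _.
clearbody p q r t.
by lra.
Qed.

(** The leading e0 supplies the factor 1/n that makes the series converge; each further letter
    raises the bound by 2. *)
Lemma sum_pcoef_bound u N : \sum_(n < N) pcoef (false :: u) n <= 2 * (size u)%:R.
Proof.
elim: u N => [|x u IH] N /=.
  rewrite mulr0 big1 // => -[[|n] ?] _ /=; rewrite ?mul0r // invr0 mulr0 //.
rewrite -[(size u).+1%:R]natr1 mulrDr mulr1; case: x.
  apply: le_trans (sum_pcoef_prefix N (pcoef_ge0 u)) _.
  rewrite addrC lerD ?IH // ler_piMr //; case: u {IH} => [|x u] //=.
  by rewrite invr0 mulr0.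
have : \sum_(n < N) pcoef u n / n%:R / n%:R <= \sum_(n < N) pcoef u n / n%:R.
  apply: ler_sum => -[[|n] ?] _ /=; first by rewrite invr0 !mulr0.
  by rewrite ler_piMr ?divr_ge0 ?pcoef_ge0 // invf_le1 ?ler1n ?ltr0n.
by move/le_trans; apply; apply: le_trans (IH N) _; rewrite lerDl.
Qed.

End NestedSums.

Section ZetaSums.
Variable R : realType.

(** [zt] peels off the smallest summation index; here the largest is split off, as [pcoef] does on
    reversed words. *)
Lemma zt_rcons k x a N :
  zt R (rcons k x) a N = \sum_(a.+1 <= n < N) zt R k a n * n%:R ^- x.
Proof.
elim: k a N => [|y k IH] a N /=.
  by apply: eq_bigr => n _; rewrite mul1r mulr1.
under eq_bigr => n _ do rewrite IH big_distrr /=.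
under [RHS]eq_bigr => n _ do rewrite big_distrl /=.
under eq_big_nat => m /andP[am _].
  rewrite (big_nat_widenl _ a.+1) //; last by rewrite ltnS ltnW.
  over.
rewrite (exchange_big_dep_nat predT) //=.
apply: eq_big_nat => n /andP[an nN].
rewrite [RHS](big_nat_widen _ _ N) 1?ltnW //=.
by apply: eq_big => m; rewrite ?mulrA.
Qed.

Lemma sum_pcoef_wordOf k N : all (fun x => 0 < x)%N k ->
  \sum_(n < N.+1) pcoef R (rev (wordOf k)) n = zt R k 0 N.+1.
Proof.
elim/last_ind: k N => [|k x IH] N.
  by rewrite /= big_ord_recl /= big1 ?addr0.
rewrite all_rcons => /andP[x0 k0].
rewrite wordOf_rcons rev_cat rev_cons rev_nseq cat_rcons zt_rcons.
rewrite big_ord_recl big_add1 /= big_mkord.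
rewrite {1}pcoef_nseq pcoef_cons0 mul0r add0r.
apply: eq_bigr => i _; rewrite pcoef_nseq /= /bump /= add1n IH // -mulrA; congr (_ * _).
by rewrite -invfM -exprS prednK.
Qed.

End ZetaSums.

(** * Convergent values and the regularized character *)

Section ZetaShuffle.
Variable R : realType.
Implicit Types (u v w : word).
Local Open Scope classical_set_scope.

(** For nonnegative terms: the triangle i + j < N lies in the square i, j < N, which lies in the
    triangle i + j < 2N. *)
Lemma cvg_cauchy_prod (a b : nat -> R) (A B C : R) :
  (forall n, 0 <= a n) -> (forall n, 0 <= b n) ->
  (fun N => \sum_(n < N) a n) @ \oo --> A ->
  (fun N => \sum_(n < N) b n) @ \oo --> B ->
  (fun N => \sum_(n < N) cauchy_prod a b n) @ \oo --> C -> A * B = C.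
Proof.
move=> a0 b0 cA cB cC.
have sum_le (c : nat -> R) N M : (forall n, 0 <= c n) -> (N <= M)%N ->
    \sum_(n < N) c n <= \sum_(n < M) c n :> R.
  move=> c0 NM; rewrite -!(big_mkord predT) [leRHS](big_cat_nat _ NM) //= lerDl.
  by apply: sumr_ge0.
have conv0 n : 0 <= cauchy_prod a b n by apply: sumr_ge0 => i _; rewrite mulr_ge0.
have cAB : (fun N => (\sum_(n < N) a n) * (\sum_(n < N) b n)) @ \oo --> A * B.
  exact: cvgM.
apply/eqP; rewrite eq_le; apply/andP; split.
  apply: (ler_cvg_to cAB (cvg_cst C)); apply: nearW => N /=.
  apply: (@le_trans _ _ (\sum_(n < N + N) cauchy_prod a b n)).
    rewrite sum_cauchy_prod mulr_suml.
    apply: (@le_trans _ _ (\sum_(i < N) a i * \sum_(j < N + N - i) b j)).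
      apply: ler_sum => i _; apply: ler_wpM2l => //; apply: sum_le => //.
      by rewrite -addnBA ?leq_addr // ltnW.
    apply: (@sum_le (fun i => a i * \sum_(j < N + N - i) b j)); last exact: leq_addr.
    by move=> n; rewrite mulr_ge0 ?sumr_ge0.
  rewrite -(cvg_lim _ cC) //; apply: nondecreasing_cvgn_le.
    by move=> n m; apply: sum_le.
  by apply/cvg_ex; exists C.
apply: (ler_cvg_to cC cAB); apply: nearW => N /=.
rewrite sum_cauchy_prod mulr_suml; apply: ler_sum => i _; apply: ler_wpM2l => //.
by apply: sum_le => //; rewrite leq_subr.
Qed.

Definition psum u : R := limn (fun N => \sum_(n < N) pcoef R u n).

Lemma cvg_psum u : last true u -> nonlead true u ->
  (fun N => \sum_(n < N) pcoef R u n) @ \oo --> psum u.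
Proof.
move=> Qu nu; apply: nondecreasing_is_cvgn.
  move=> N M NM; rewrite -!(big_mkord predT) [leRHS](big_cat_nat _ NM) //= lerDl.
  by apply: sumr_ge0 => n _; apply: pcoef_ge0.
case: u Qu nu => [|[] u] // _ _.
  exists 1 => _ [N _ <-]; case: N => [|N]; first by rewrite big_ord0.
  by rewrite big_ord_recl big1 ?addr0.
by exists (2 * (size u)%:R) => _ [N _ <-]; apply: sum_pcoef_bound.
Qed.

Lemma nonlead_shrev c u v z : nonlead c u -> nonlead c v -> z \in shrev u v -> nonlead c z.
Proof.
case: u => [|x u]; first by move=> _ nv; rewrite inE => /eqP->.
case: v => [|y v] nu nv; first by rewrite inE => /eqP->.
by rewrite mem_cat => /orP[] /mapP[t _ ->].
Qed.

Lemma last_shrev b u v z : last b u = b -> last b v = b -> z \in shrev u v -> last b z = b.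
Proof.
elim: u v z => [|x u IHu] v z; first by move=> _ nv; rewrite inE => /eqP->.
elim: v z => [|y v IHv] z lu lv; first by rewrite inE => /eqP->.
have lu' : last b u = b by case: (u) lu.
have lv' : last b v = b by case: (v) lv.
rewrite mem_cat => /orP[] /mapP[t tin ->].
  by have := IHv _ lu lv' tin; have := @size_shrev (x :: u) v t tin; case: (t).
by have := IHu _ _ lu' lv tin; have := size_shrev tin; rewrite addnS; case: (t).
Qed.

Lemma psumM u v : last true u -> last true v -> nonlead true u -> nonlead true v ->
  psum u * psum v = shsum psum u v.
Proof.
move=> Qu Qv nu nv.
apply: cvg_cauchy_prod (cvg_psum Qu nu) (cvg_psum Qv nv) _; try by move=> n; apply: pcoef_ge0.
under eq_fun => N.
  under eq_bigr => n _ do rewrite pcoefM //.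
  rewrite /shsum exchange_big big_seq /=; over.
rewrite /shsum big_seq; apply: cvg_big => //.
  exact: add_continuous.
move=> z zin; apply: cvg_psum; last exact: nonlead_shrev zin.
exact: last_shrev zin.
Qed.

Lemma Zw_rev u : last true u -> nonlead true u ->
  Zw R (rev u) = (-1) ^+ count id u * psum u.
Proof.
move=> Qu nu.
have hu : head true (rev u).
  by move: Qu; rewrite -{1}(revK u); case: (rev u) => //= x w; rewrite rev_cons last_rcons.
rewrite /Zw count_idx // count_rev; congr (_ * _).
have [k [k0 uk]] := wordOfP hu.
rewrite uk idx_wordOf //; apply: cvg_lim => //.
have E : [sequence zt R k 0 N.+1]_N = [sequence \sum_(n < N.+1) pcoef R u n]_N.
  by apply/funext => N /=; rewrite -sum_pcoef_wordOf // -uk revK.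
rewrite -cvg_shiftS E (cvg_shiftS (fun N => \sum_(n < N) pcoef R u n)).
exact: cvg_psum.
Qed.

Lemma Zw_rev_shuffle u v : nonlead true u -> nonlead true v ->
  last true u -> last true v ->
  shsum (fun z => Zw R (rev z)) u v = Zw R (rev u) * Zw R (rev v).
Proof.
move=> nu nv Qu Qv; rewrite !Zw_rev // mulrACA -exprD psumM // -shsumZ.
apply: eq_in_shsum => z zin; rewrite Zw_rev.
- by rewrite (permP (perm_shrev zin)) count_cat.
- exact: last_shrev zin.
- exact: nonlead_shrev zin.
Qed.

(** The character Z on all words: value 0 at e0, and [Zsh 0] on H^1. *)
Definition Zreg : word -> R := ext false (Zsh 0).

Lemma zreg_rev m v : zreg 0 m v = reg true (fun z => Zw R (rev z)) m (rev v).
Proof.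
(* Inserting [c] anywhere before the final letter [x] shuffles [c] with [w]; after reversal this is
   the recursion of [reg]. *)
have ins (f : word -> R) c x w :
    \sum_(i < (size w).+1) f (take i (rcons w x) ++ c :: drop i (rcons w x))
    = shsum (fun z => f (rcons z x)) [:: c] w.
  elim: w f => [|y w IH] f; first by rewrite big_ord1 shsum0r.
  rewrite big_ord_recl shsum_cons shsum0l; congr (_ + _).
  by rewrite -(IH (fun z => f (y :: z))); apply: eq_bigr.
elim: m v => [|m IH] v /=; first by rewrite revK.
rewrite oppr0 mul0r add0r; congr (- _ / _).
elim/last_ind: v => [|v x _]; first by rewrite big_ord0.
rewrite size_rcons ins rev_rcons -{2}(revK [:: true]) shsum_rev /=.
by apply: eq_shsum => z; rewrite IH rev_rcons.
Qed.

Lemma Zsh_rev w : Zsh 0 w = ext true (fun z => Zw R (rev z)) (rev w).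
Proof.
rewrite /Zsh zreg_rev /ext.
have -> : find negb (rev w) = find (fun x => x != true) (rev w) by apply: eq_find; case.
congr (reg _ _ _ _); rewrite -[w in take _ w]revK take_rev revK size_rev.
by rewrite subKn // -[in X in (_ <= X)%N](size_rev w) find_size.
Qed.

Lemma ext_rev_shuffle u v : last true u -> last true v ->
  let h := ext true (fun z => Zw R (rev z)) in shsum h u v = h u * h v.
Proof.
apply: (@shuffle_hom_lead _ true (last true)) => //.
- by move=> u' v' z; apply: last_shrev.
- by move=> w _; apply: ext_shsum.
move=> u' v' nu nv Qu Qv.
have extE w : nonlead true w -> ext true (fun z => Zw R (rev z)) w = Zw R (rev w).
  exact: (@ext_nseq _ _ _ 0).
rewrite !extE // -Zw_rev_shuffle //; apply: eq_in_shsum => z zin.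
by rewrite extE //; apply: nonlead_shrev zin.
Qed.

Lemma Zsh_shuffle u v : nonlead false u -> nonlead false v ->
  shsum (Zsh 0) u v = Zsh 0 u * Zsh 0 v :> R.
Proof.
move=> nu nv; have lastE w : nonlead false w -> last true (rev w).
  by case: w => //= x w; rewrite rev_cons last_rcons; case: x.
rewrite !Zsh_rev -ext_rev_shuffle ?lastE // shsum_rev.
by apply: eq_shsum => z; rewrite Zsh_rev.
Qed.

Lemma Zreg_nonlead w : nonlead false w -> Zreg w = Zsh 0 w.
Proof. exact: (@ext_nseq _ _ _ 0). Qed.

Lemma Zreg_hom : shuffle_hom Zreg.
Proof.
split.
  rewrite Zreg_nonlead // Zsh_rev /ext /= /Zw /= mul1r /mzv /=.
  by apply: cvg_lim => //; apply: cvg_cst.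
move=> u v; apply: (@shuffle_hom_lead _ false predT) => //.
  by move=> w _; apply: ext_shsum.
move=> {}u {}v nu nv _ _; rewrite !Zreg_nonlead // -Zsh_shuffle //.
by apply: eq_in_shsum => z zin; rewrite Zreg_nonlead //; apply: nonlead_shrev zin.
Qed.

Lemma Zreg_nseq0 n : Zreg (nseq n.+1 false) = 0.
Proof. by rewrite -(cats0 (nseq _ _)) /Zreg ext_nseq //= oppr0 mul0r. Qed.

End ZetaShuffle.

(** * Symmetric values as coefficients of a Lie series *)

Section IndexSums.
Variable R : comNzRingType.
Implicit Types (f : word -> R) (k n : seq nat).

Lemma cosum_nseq (phi : word -> word -> R) x c :
  cosum phi (nseq c x) = \sum_(j < c.+1) phi (nseq j x) (nseq (c - j) x).
Proof.
elim: c phi => [|c IH] phi; first by rewrite big_ord1.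
by rewrite /= IH [RHS]big_ord_recl; congr (_ + _); apply: eq_bigr.
Qed.

Lemma shsum_nseq f x c d :
  shsum f (nseq c x) (nseq d x) = 'C(d + c, c)%:R * f (nseq (d + c) x).
Proof.
elim: c d f => [|c IHc] d f; first by rewrite shsum0l addn0 bin0 mul1r.
elim: d f => [|d IHd] f; first by rewrite shsum0r add0n binn mul1r.
rewrite (shsum_cons f x x (nseq c x) (nseq d x)) (IHc d.+1) (IHd (fun z => f (x :: z))).
by rewrite !addSn !addnS -mulrDl -natrD addnC -binS.
Qed.

(** The shape of a coefficient of a shifted value, with [f] in place of the regularized zeta. *)
Definition insert_sum f k a : R :=
  \sum_(n <- wcomps (size k) a) (bcoef k n)%:R * f (wordOf (oplus k n)).

Lemma insert_sum_nil f a : insert_sum f [::] a = (a == 0%N)%:R * f [::].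
Proof.
rewrite /insert_sum /=; case: (a == 0%N).
  by rewrite big_seq1 /bcoef big_nil.
by rewrite big_nil mul0r.
Qed.

Lemma insert_sum_cons f x k a : insert_sum f (x :: k) a =
  \sum_(j < a.+1) 'C(x + j - 1, j)%:R *
    insert_sum (fun w => f (true :: nseq (x + j).-1 false ++ w)) k (a - j).
Proof.
rewrite /insert_sum big_flatten big_map -[iota 0 a.+1]/(index_iota 0 a.+1) big_mkord.
apply: eq_bigr => j _; rewrite big_map big_distrr /=.
by apply: eq_bigr => n _; rewrite /bcoef big_cons natrM mulrA.
Qed.

Lemma eq_insert_sum f g k a : (forall m, f (wordOf m) = g (wordOf m)) ->
  insert_sum f k a = insert_sum g k a.
Proof. by move=> fg; apply: eq_bigr => n _; rewrite fg. Qed.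

(** Shuffling j zeros into a run e0^d gives the same word C(d+j, j) times; over all blocks e1
    e0^(x-1) this produces the binomials b(k;n). *)
Lemma shsum_zeros f c d k : all (fun x => 0 < x)%N k ->
  shsum f (nseq c false) (nseq d false ++ wordOf k) =
  \sum_(j < c.+1) 'C(d + j, j)%:R *
    insert_sum (fun w => f (nseq (d + j) false ++ w)) k (c - j).
Proof.
elim: k c d f => [|x k IH] c d f k0.
  rewrite cats0 shsum_nseq big_ord_recr /= insert_sum_nil subnn mul1r cats0.
  rewrite big1 ?add0r // => i _; rewrite insert_sum_nil subn_eq0.
  by rewrite leqNgt ltn_ord mul0r mulr0.
have /andP[x0 {}k0] := k0.
rewrite shsum_deconc cosum_nseq; apply: eq_bigr => j _.
rewrite shsum_nseq (IH _ _ _ k0); congr (_ * _); rewrite insert_sum_cons.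
by apply: eq_bigr => i _; case: x x0 => // x _; rewrite addSn subSS subn0.
Qed.

Lemma shsum_zeros_wordOf f c k : all (fun x => 0 < x)%N k ->
  shsum f (nseq c false) (wordOf k) =
  \sum_(j < c.+1) insert_sum (fun w => f (nseq (c - j) false ++ w)) k j.
Proof.
move=> k0; have := shsum_zeros f c 0 k0; rewrite /= => ->.
rewrite (reindex_inj rev_ord_inj); apply: eq_bigr => j _.
by rewrite /= add0n binn mul1r subSS subKn // -ltnS.
Qed.

Lemma size_wordOf k : all (fun x => 0 < x)%N k -> size (wordOf k) = sumn k.
Proof.
elim: k => //= x k IH /andP[x0 /IH <-].
by rewrite /wordOf /= size_cat size_nseq -addSn prednK.
Qed.

(** Reversal turns a block e1 e0^(x-1) into e0^(x-1) e1; the extra e1 in front realigns the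
    blocks. *)
Lemma rev_wordOf k : true :: rev (wordOf (rev k)) = rcons (wordOf k) true.
Proof.
elim: k => //= x k IH.
rewrite rev_cons wordOf_rcons rev_cat rev_cons rev_nseq cat_rcons IH.
by rewrite rcons_cat.
Qed.

Lemma wcomps_size r a n : n \in wcomps r a -> size n = r.
Proof.
elim: r a n => [|r IH] a n; first by rewrite /=; case: (a == 0%N); rewrite // inE => /eqP->.
by case/flattenP => s /mapP[j _ ->] /mapP[m /IH <- ->].
Qed.

Lemma oplus_gt0 k n : all (fun x => 0 < x)%N k -> all (fun x => 0 < x)%N (oplus k n).
Proof.
elim: k n => [|x k IH] [|y n] //= /andP[x0 k0].
by rewrite addn_gt0 x0 IH.
Qed.

Lemma cosum_e1_nseq (phi : word -> word -> R) a w :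
  cosum (fun p q => if q is true :: q' then phi p q' else 0) (nseq a false ++ w) =
  cosum (fun p q => if q is true :: q' then phi (nseq a false ++ p) q' else 0) w.
Proof.
by elim: a phi => //= a IH phi; rewrite add0r (IH (fun p => phi (false :: p))).
Qed.

(** Cutting e_k e1 e0^b at its r + 1 letters e1 yields the pairs k_[i], k^[i] from the definition of
    the symmetric value. *)
Lemma cosum_e1_wordOf (phi : word -> word -> R) k b :
  cosum (fun p q => if q is true :: q' then phi p q' else 0)
    (wordOf k ++ true :: nseq b false) =
  \sum_(i < (size k).+1)
    phi (wordOf (take i k)) (rev (nseq b false ++ wordOf (rev (drop i k)))).
Proof.
elim: k phi => [|x k IH] phi.
  rewrite big_ord1 /= cats0 rev_nseq.
  have := cosum_e1_nseq (fun p => phi (true :: p)) b [::]; rewrite cats0 => -> /=.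
  by rewrite addr0.
have -> : wordOf (x :: k) = true :: nseq x.-1 false ++ wordOf k by [].
rewrite /= -catA (cosum_e1_nseq (fun p => phi (true :: p))).
rewrite (IH (fun p => phi (true :: nseq x.-1 false ++ p))).
rewrite [RHS]big_ord_recl /=; congr (phi _ _ + _).
rewrite rev_cat rev_nseq rev_cons wordOf_rcons rev_cat rev_cons rev_nseq cat_rcons.
by rewrite rev_wordOf -cats1 -!catA.
Qed.

End IndexSums.

Section SymmetricZeta.
Variable R : realType.
Implicit Types (k l : seq nat) (a b : nat).
Let Z := @Zreg R.

(** [shsum_cat_antipode] with empty [w] applies because Z vanishes on nonempty powers of e0, hence
    on their shuffles. *)
Lemma Zreg_lead a x : Z (nseq a false ++ true :: x) =
  (-1) ^+ a * shsum (fun z => Z (true :: z)) (nseq a false) x.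
Proof.
have := @shsum_cat_antipode _ Z (nseq a false) [::] true x.
rewrite shsum0r rev_nseq size_nseq; apply => p y.
rewrite prefixE => /eqP pE p0 _.
have -> : p = nseq (size p) false.
  by apply/all_pred1P; rewrite -pE; apply/allP => z /mem_take; rewrite mem_nseq => /andP[].
by rewrite (Zreg_hom R).2; case: (p) p0 => // c p' _; rewrite Zreg_nseq0 mul0r.
Qed.

(** Shuffling e0^a into what follows the first e1 of e_k inserts zeros in all blocks with weights
    b(k;n); [Zreg_lead] trades this for zeros in front of e_k, with sign (-1)^a. *)
Lemma insert_sum_Zsh k a : all (fun x => 0 < x)%N k ->
  insert_sum (Zsh 0) k a = (-1) ^+ a * Z (nseq a false ++ wordOf k).
Proof.
move=> k0; rewrite (@eq_insert_sum _ _ Z); last first.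
  by move=> m; rewrite /Z Zreg_nonlead //; case: m.
case: k k0 => [|x k] k0.
  rewrite insert_sum_nil cats0; case: a => [|a]; first by rewrite mul1r.
  by rewrite /Z Zreg_nseq0 mul0r mulr0.
have /andP[x0 {}k0] := k0.
rewrite Zreg_lead mulrA -exprMn mulrNN mulr1 expr1n mul1r shsum_zeros //.
rewrite insert_sum_cons; apply: eq_bigr => i _.
by case: x x0 => // x _; rewrite addSn subSS subn0.
Qed.

Lemma shiftcE c k a : all (fun x => 0 < x)%N k ->
  shiftc c 0 k a = (-1) ^+ size k * c ^+ a * Z (nseq a false ++ wordOf k).
Proof.
move=> k0; transitivity ((-1) ^+ size k * (- c) ^+ a * insert_sum (Zsh (0 : R)) k a).
  rewrite /shiftc big_distrr; apply: eq_big_seq => n /wcomps_size sn; rewrite /zsh.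
  have -> : size (oplus k n) = size k by rewrite size_map size_zip sn minnn.
  by rewrite /=; ring.
by rewrite insert_sum_Zsh // mulrA -[_ * _ * (-1) ^+ a]mulrA -exprMn mulrN1 opprK.
Qed.

Definition Fcoef := conj_coef Z.

(** At each cut, Z on the left part is the s-shifted value of k_[i]. The antipode on the right part
    supplies the reversal, the sign (-1)^wt and the sign (-1)^b of the shift by -t. *)
Lemma zhatcE k a b : all (fun x => 0 < x)%N k ->
  zhatc 0 0 k a b =
  (-1) ^+ size k * Fcoef (nseq a false ++ wordOf k ++ true :: nseq b false).
Proof.
move=> k0; rewrite /Fcoef /conj_coef.
rewrite (eq_cosum (psi := fun p q => if q is true :: q' then Z p * antipode Z q' else 0));
  last by move=> p [|[] q]; rewrite ?mulr0.
rewrite (cosum_e1_nseq (fun p q => Z p * antipode Z q)).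
rewrite (cosum_e1_wordOf (fun p q => Z (nseq a false ++ p) * antipode Z q)).
rewrite big_distrr; apply: eq_bigr => i _ /=.
move: k0; rewrite -{1}(cat_take_drop i k) all_cat => /andP[kt kd].
rewrite !shiftcE ?all_rev // /antipode revK !size_rev size_cat size_nseq.
rewrite size_wordOf ?all_rev // sumn_rev expr1n mulr1 exprD.
have -> : (-1) ^+ size k = (-1) ^+ size (take i k) * (-1) ^+ size (drop i k) :> R.
  by rewrite -exprD -size_cat cat_take_drop.
by ring.
Qed.

Lemma zhatw_e1 w a b : head true w ->
  zhatw 0 0 w a b = Fcoef (nseq a false ++ w ++ true :: nseq b false).
Proof.
move=> /wordOfP[k [k0 ->]]; rewrite /zhatw idx_wordOf // eqxx zhatcE // mulrA.
by rewrite -exprMn mulrNN mulr1 expr1n mul1r.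
Qed.

(* the two parts of the coefficient cancel except on words starting with e1 *)
Lemma shs_coef_e1 (h g : word -> R) (u v : word) m :
  head true u -> head true v -> (forall w, head true w -> h w = g w) ->
  \sum_(p <- shs_coef u v m) (p.1)%:~R * h p.2 =
  shsum g u (nseq m false ++ v) -
  (if m is m'.+1 then shsum (fun z => g (false :: z)) u (nseq m' false ++ v) else 0).
Proof.
move=> hu hv hg; have shE (f : word -> R) : \sum_(p <- shs_coef u v m) (p.1)%:~R * f p.2 =
  shsum f u (nseq m false ++ v) -
  (if m is m'.+1 then shsum (fun z => f (false :: z)) u (nseq m' false ++ v) else 0).
  rewrite /shs_coef big_cat big_map sum_shuffle; congr (_ + _).
    by apply: eq_shsum => z; rewrite mul1r.
  case: m => [|m]; first by rewrite big_nil oppr0.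
  rewrite big_map sum_shuffle -[RHS]mulN1r -shsumZ.
  by apply: eq_shsum => z; rewrite mulrNz.
rewrite shE; case: m {shE} => [|m].
  rewrite !subr0; apply: eq_in_shsum => z zin; apply: hg; move: zin.
  have H w : head true w = nonlead false w by case: w => [|[]].
  by rewrite H; apply: nonlead_shrev; rewrite -H.
case: u hu => [|[] u] // _; first by rewrite !shsum0l !subrr.
rewrite /= !shsum_cons !addrK; apply: eq_shsum => z; exact: hg.
Qed.

(** The zeros e0^(a-m) in front assemble to (1 - e0 s)^-1, which cancels the factor 1 - e0 s of the
    shifted product: the sum over m telescopes to m = a. *)
Lemma lhs_coefE k l a b : all (fun x => 0 < x)%N k -> all (fun x => 0 < x)%N l ->
  lhs_coef R l k a b = (-1) ^+ (size l + size k) *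
    shsum (fun z => Fcoef (z ++ true :: nseq b false)) (wordOf l)
      (nseq a false ++ wordOf k).
Proof.
move=> k0 l0; rewrite /lhs_coef; congr (_ * _).
have h1 (s : seq nat) : head true (wordOf s) by case: s.
pose X m c := shsum (fun z => Fcoef (nseq c false ++ z ++ true :: nseq b false))
  (wordOf l) (nseq m false ++ wordOf k).
have cat_nseq c w : nseq c false ++ false :: w = nseq c.+1 false ++ w.
  by elim: c => //= c ->.
have E (m : 'I_a.+1) : true -> \sum_(p <- shs_coef (wordOf l) (wordOf k) m)
    (p.1)%:~R * zhatw 0 0 p.2 (a - m) b =
    X m (a - m)%N - (if m : nat is m'.+1 then X m' (a - m')%N else 0).
  move=> _; rewrite (shs_coef_e1 _ _ _ (fun w => @zhatw_e1 w (a - m) b)) //.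
  case: m => [[|m] ltm] //=; congr (_ - _); apply: eq_shsum => z.
  by rewrite -[(a - m)%N]prednK ?subn_gt0 // -subnS cat_nseq.
rewrite (eq_bigr _ E); pose Y m := X m (a - m)%N.
suff tele N : \sum_(m < N.+1) (Y m - (if m : nat is m'.+1 then Y m' else 0)) = Y N.
  by rewrite tele /Y subnn.
elim: N => [|N IH]; first by rewrite big_ord1 subr0.
by rewrite big_ord_recr IH /= addrC subrK.
Qed.

(** After reversal, e0^b is shuffled with e_l: c zeros enter the blocks, giving b(l;n), and the b -
    c in front become the trailing zeros. *)
Lemma rhs_coefE k l a b : all (fun x => 0 < x)%N k -> all (fun x => 0 < x)%N l ->
  rhs_coef R l k a b = (-1) ^+ sumn l * (-1) ^+ (size l + size k) *
    shsum (fun z => Fcoef ((nseq a false ++ wordOf k) ++ true :: z))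
      (rev (wordOf l)) (nseq b false).
Proof.
move=> k0 l0; rewrite /rhs_coef -mulrA; congr (_ * _).
pose G (w : word) := Fcoef ((nseq a false ++ wordOf k) ++ true :: rev w).
rewrite -[nseq b false]revK shsum_rev rev_nseq shsumC -/G.
rewrite shsum_zeros_wordOf // big_distrr; apply: eq_bigr => c _.
rewrite /insert_sum big_distrr.
apply: eq_big_seq => n /wcomps_size sn.
have so : size (oplus l n) = size l by rewrite size_map size_zip sn minnn.
rewrite zhatcE; last by rewrite all_cat k0 all_rev oplus_gt0.
rewrite size_cat size_rev so addnC mulrCA; congr (_ * (_ * _)); rewrite /G.
congr Fcoef; rewrite /wordOf map_cat flatten_cat -/(wordOf k) -/(wordOf (rev _)).
rewrite -!catA; congr (_ ++ (_ ++ _)); rewrite rev_cat rev_nseq -cat_cons.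
by rewrite -[oplus l n in RHS]revK rev_wordOf cat_rcons.
Qed.

End SymmetricZeta.

Theorem theorem1p2 (R : realType) (k l : seq nat) :
  all (fun x => 0 < x)%N k -> all (fun x => 0 < x)%N l ->
  forall a b : nat, lhs_coef R l k a b = rhs_coef R l k a b.
Proof.
(* The sign (-1)^wt(l) is that of the antipode on e_l, a word of length wt(l). *)
move=> k0 l0 a b; rewrite lhs_coefE // rhs_coefE // shsum_cat_antipode.
  by rewrite size_wordOf // mulrA [_ * (-1) ^+ sumn l]mulrC.
by move=> p y _ p0 y0; apply: conj_coef_shuffle => //; apply: Zreg_hom.
Qed.
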